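(* Let $n$ be a non-negative integer and $s$ any integer. Then \[ \sum_{j = 0}^{2n} \frac{F_{j + s}}{2^{j + 1} \binom {2n}j} = \frac{2n + 1}{5^{n + 1}}\left( F_{s - 1} \sum_{j = 1}^n \frac{5^j}{2j} + L_{s - 1} \sum_{j = 0}^n \frac{5^j}{2j + 1} \right) + \frac{2n + 1}{5^{n + 1}}\left( \sum_{j = 1}^n \frac{5^j F_{2j + s - 1}}{2^{2j}\, 2j} + \sum_{j = 0}^n \frac{5^j L_{2j + s}}{2^{2j + 1} (2j + 1)} \right), \] and \[ \sum_{j = 0}^{2n} \frac{L_{j + s}}{2^{j + 1} \binom {2n}j} = \frac{2n + 1}{5^n}\left( F_{s - 1} \sum_{j = 0}^n \frac{5^j}{2j + 1} + L_{s - 1} \sum_{j = 1}^n \frac{5^{j - 1}}{2j} \right) + \frac{2n + 1}{5^n}\left( \sum_{j = 0}^n \frac{5^j F_{2j + s}}{2^{2j + 1} (2j + 1)} + \sum_{j = 1}^n \frac{5^{j - 1} L_{2j + s - 1}}{2^{2j}\, 2j} \right). \]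
   Context: $F_j$ and $L_j$ denote the Fibonacci and Lucas numbers, defined for all integers $j$ by $F_0=0$, $F_1=1$, $L_0=2$, $L_1=1$, $F_j=F_{j-1}+F_{j-2}$, $L_j=L_{j-1}+L_{j-2}$, extended to negative indices by $F_{-j}=(-1)^{j-1}F_j$, $L_{-j}=(-1)^jL_j$; equivalently $F_j=(\alpha^j-\beta^j)/\sqrt5$, $L_j=\alpha^j+\beta^j$ with $\alpha=(1+\sqrt5)/2$, $\beta=(1-\sqrt5)/2$. Empty sums are zero. *)

(* Defs.v *)
From HB Require Import structures.
From mathcomp Require Import all_boot all_order all_algebra.
From mathcomp Require Import zify ring.

Set Implicit Arguments.
Unset Strict Implicit.
Unset Printing Implicit Defensive.

Import Order.TTheory GRing.Theory Num.Theory.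
Local Open Scope ring_scope.

Fixpoint fib_nat (n : nat) : nat :=
  match n with
  | 0 => 0
  | 1 => 1
  | (m.+1 as p).+1 => fib_nat p + fib_nat m
  end%N.

Fixpoint lucas_nat (n : nat) : nat :=
  match n with
  | 0 => 2
  | 1 => 1
  | (m.+1 as p).+1 => lucas_nat p + lucas_nat m
  end%N.

(* [Negz m] is the integer -(m+1), so the negative branches below read
   F_{-(m+1)} = (-1)^m F_{m+1} and L_{-(m+1)} = (-1)^(m+1) L_{m+1}. *)
Definition fib (j : int) : int :=
  match j with
  | Posz n => (fib_nat n)%:Z
  | Negz m => (-1) ^+ m * (fib_nat m.+1)%:Z
  end.

Definition lucas (j : int) : int :=
  match j with
  | Posz n => (lucas_nat n)%:Z
  | Negz m => (-1) ^+ m.+1 * (lucas_nat m.+1)%:Z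
  end.

Lemma fib_natSS n : fib_nat n.+2 = (fib_nat n.+1 + fib_nat n)%N.
Proof. by []. Qed.

Lemma lucas_natSS n : lucas_nat n.+2 = (lucas_nat n.+1 + lucas_nat n)%N.
Proof. by []. Qed.

Lemma fibN (n : nat) : fib (- n%:Z) = - (-1) ^+ n * fib n%:Z.
Proof.
case: n => [|n]; first by rewrite /= mulr0.
by rewrite -NegzE /fib exprS mulN1r opprK.
Qed.

Lemma lucasN (n : nat) : lucas (- n%:Z) = (-1) ^+ n * lucas n%:Z.
Proof. by case: n => [|n] //; rewrite -NegzE. Qed.

Lemma fib_rec (j : int) : fib j = fib (j - 1) + fib (j - 2).
Proof.
case: j => [[|[|n]]|n] //.
- have -> : n.+2%:Z - 1 = n.+1%:Z by lia.
  have -> : n.+2%:Z - 2 = n%:Z by lia.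
  by rewrite /fib fib_natSS PoszD.
- have -> : Negz n - 1 = Negz n.+1 by lia.
  have -> : Negz n - 2 = Negz n.+2 by lia.
  by rewrite /fib !fib_natSS !PoszD !exprS; ring.
Qed.

Lemma lucas_rec (j : int) : lucas j = lucas (j - 1) + lucas (j - 2).
Proof.
case: j => [[|[|n]]|n] //.
- have -> : n.+2%:Z - 1 = n.+1%:Z by lia.
  have -> : n.+2%:Z - 2 = n%:Z by lia.
  by rewrite /lucas lucas_natSS PoszD.
- have -> : Negz n - 1 = Negz n.+1 by lia.
  have -> : Negz n - 2 = Negz n.+2 by lia.
  by rewrite /lucas !lucas_natSS !PoszD !exprS; ring.
Qed.

Notation "''F_[' j ]" := ((fib j)%:~R : rat)
  (at level 8, j at level 200, format "''F_[' j ]") : ring_scope.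
Notation "''L_[' j ]" := ((lucas j)%:~R : rat)
  (at level 8, j at level 200, format "''L_[' j ]") : ring_scope.

(* Main.v *)
(** The weights [beta_weight m j = 1 / ((m + 1) * 'C(m, j))], which are the Beta
    integrals of [x^j (1 - x)^(m - j)], satisfy the dual Pascal rule
    [b (m+1) j + b (m+1) (j+1) = b m j].  Summation by parts therefore relates the
    weighted sums [beta_sum] of levels [m + 1] and [m].  On
    [u j = G_(j + s) / 2^(j + 1)] the map [u j |-> u j + u (j + 1)] exchanges
    Fibonacci and Lucas numbers up to a factor [5], because
    [2 F_j + F_(j+1) = L_(j+1)] and [2 L_j + L_(j+1) = 5 F_(j+1)].  Two such steps
    go from level [2n] to level [2n + 2] and produce one new term of each sum on the
    right-hand side. *)
Require Import Defs.
From HB Require Import structures.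
From mathcomp Require Import all_boot all_order all_algebra.
From mathcomp Require Import zify ring lra.
Import Order.TTheory GRing.Theory Num.Theory.
Local Open Scope ring_scope.

Lemma lucas_fib (j : int) : lucas (j + 1) = 2 * fib j + fib (j + 1).
Proof.
(* The recurrences have order two, so the instance at [j - 1] is carried along; the induction runs
   from 0 in both directions. *)
suff [] : lucas (j + 1) = 2 * fib j + fib (j + 1)
       /\ lucas j = 2 * fib (j - 1) + fib j by [].
elim/int_ind: j => [|n [IH1 IH2]|n [IH1 IH2]] //.
- have [e1 e2] : n.+1%:Z + 1 - 1 = n%:Z + 1 /\ n.+1%:Z + 1 - 2 = n%:Z by lia.
  have := fib_rec (n.+1%:Z + 1); have := lucas_rec (n.+1%:Z + 1).
  have := fib_rec (n%:Z + 1).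
  have [-> ->] : n%:Z + 1 - 1 = n%:Z /\ n%:Z + 1 - 2 = n%:Z - 1 by lia.
  rewrite e1 e2.
  have [-> ->] : n.+1%:Z = n%:Z + 1 /\ n%:Z + 1 - 1 = n%:Z by lia.
  by move: IH1 IH2 => *; split; lra.
- have := fib_rec (- n%:Z + 1); have := lucas_rec (- n%:Z + 1).
  have := fib_rec (- n%:Z).
  have [-> ->] : - n%:Z + 1 - 1 = - n%:Z /\ - n%:Z + 1 - 2 = - n%:Z - 1 by lia.
  have [-> ->] : - n.+1%:Z + 1 = - n%:Z /\ - n.+1%:Z = - n%:Z - 1 by lia.
  have -> : - n%:Z - 1 - 1 = - n%:Z - 2 by lia.
  by move: IH1 IH2 => *; split; lra.
Qed.

(** Expanding the right side by [lucas_fib] at [j - 1] and [j] gives 4 F_(j-1) + 4 F_j + F_(j+1),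
    and the first two terms add up to 4 F_(j+1). *)
Lemma fib_lucas (j : int) : 5 * fib (j + 1) = 2 * lucas j + lucas (j + 1).
Proof.
have := lucas_fib j; have := lucas_fib (j - 1); have := fib_rec (j + 1).
have [-> ->] : j + 1 - 1 = j /\ j + 1 - 2 = j - 1 by lia.
by rewrite subrK => *; lra.
Qed.

Definition beta_weight (m j : nat) : rat := (m.+1%:R * 'C(m, j)%:R)^-1.

Definition beta_sum (m : nat) (u : nat -> rat) : rat :=
  \sum_(0 <= j < m.+1) u j * beta_weight m j.

(** Both binomials of row [m.+1] are multiples of ['C(m, j)], by (m+1)/(m+1-j) and (m+1)/(j+1).
    Inverting puts m+1-j and j+1 in the numerators; their sum m+2 cancels the prefactor. *)
Lemma beta_weight_pascal m j : (j <= m)%N ->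
  beta_weight m.+1 j + beta_weight m.+1 j.+1 = beta_weight m j.
Proof.
move=> le_jm; rewrite /beta_weight.
have ltS : (m.+1 - j)%:R != 0 :> rat by rewrite pnatr_eq0; lia.
have c0 : 'C(m, j)%:R != 0 :> rat by rewrite pnatr_eq0 -lt0n bin_gt0.
have jS0 : j.+1%:R != 0 :> rat by rewrite pnatr_eq0.
have mS0 : m.+1%:R != 0 :> rat by rewrite pnatr_eq0.
have mSS0 : m.+2%:R != 0 :> rat by rewrite pnatr_eq0.
have -> : 'C(m.+1, j)%:R = m.+1%:R * 'C(m, j)%:R / (m.+1 - j)%:R :> rat.
  by apply: (canRL (mulfK ltS)); rewrite -!natrM mulnC mul_bin_down.
have -> : 'C(m.+1, j.+1)%:R = m.+1%:R * 'C(m, j)%:R / j.+1%:R :> rat.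
  by apply: (canRL (mulfK jS0)); rewrite -!natrM mulnC -mul_bin_diag.
have e : m.+2%:R = (m.+1 - j)%:R + j.+1%:R :> rat.
  by rewrite -natrD; congr (_%:R); lia.
rewrite [(m.+2%:R * _)^-1 + _](_ : _ =
  ((m.+1 - j)%:R + j.+1%:R) / (m.+2%:R * (m.+1%:R * 'C(m, j)%:R))).
  by rewrite -e invfM mulVKf.
by rewrite !invfM !invrK; ring.
Qed.

(** Each inner [u j.+1] meets two neighbouring weights, which merge by the dual Pascal rule; only
    the two ends remain, both with weight 1/(m+2). *)
Lemma beta_sum_step m (u : nat -> rat) :
  beta_sum m.+1 (fun j => u j + u j.+1) =
  beta_sum m (fun j => u j.+1) + (u 0%N + u m.+2) / m.+2%:R.
Proof.
rewrite /beta_sum.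
under eq_bigr do rewrite mulrDl.
rewrite big_split /= big_nat_recl //= [X in _ + X]big_nat_recr //=.
under [in RHS]eq_big_nat => j /andP[_ lt_jm].
  rewrite -beta_weight_pascal // mulrDr; over.
by rewrite big_split /= /beta_weight bin0 binn !mulr1; ring.
Qed.

Lemma beta_sum_ext m (u v : nat -> rat) :
  u =1 v -> beta_sum m u = beta_sum m v.
Proof. by move=> uv; apply: eq_bigr => j _; rewrite uv. Qed.

Lemma beta_sumZ m (c : rat) (u : nat -> rat) :
  beta_sum m (fun j => c * u j) = c * beta_sum m u.
Proof. by rewrite /beta_sum mulr_sumr; apply: eq_bigr => j _; rewrite mulrA. Qed.

Definition halved (g : int -> int) (s : int) (j : nat) : rat :=
  (g (j%:Z + s))%:~R / 2 ^+ j.+1.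

Lemma beta_sum_halved_step (g h : int -> int) (c : int) m s :
  (forall j, c * h (j + 1) = 2 * g j + g (j + 1)) ->
  c%:~R * beta_sum m.+1 (halved h s) =
  beta_sum m (halved g s) +
  ((g (s - 1))%:~R + (g (m.+1%:Z + s))%:~R / 2 ^+ m.+2) / m.+2%:R.
Proof.
have p2 k : 2 ^+ k != 0 :> rat by rewrite expf_neq0 // pnatr_eq0.
(* With the shift [s - 1], [u j.+1] is half of [halved g s j], and [u j + u j.+1] is c/2 times
   [halved h s j]; the common factor 1/2 is cleared at the end. *)
move=> gh; have := beta_sum_step m (halved g (s - 1)).
rewrite (@beta_sum_ext _ _ (fun j => (c%:~R / 2) * halved h s j)); last first.
  move=> j; rewrite /halved.
  have [-> ->] : j%:Z + s = j%:Z + (s - 1) + 1 /\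
                 j.+1%:Z + (s - 1) = j%:Z + (s - 1) + 1 by lia.
  have := congr1 (intr : int -> rat) (gh (j%:Z + (s - 1))).
  rewrite rmorphM rmorphD rmorphM /= => e.
  transitivity ((c%:~R * (h (j%:Z + (s - 1) + 1))%:~R) / 2 / 2 ^+ j.+1 : rat).
    by rewrite e !exprS; field; rewrite p2.
  by ring.
rewrite (@beta_sum_ext m _ (fun j => 2^-1 * halved g s j)); last first.
  move=> j; rewrite /halved.
  have -> : j.+1%:Z + (s - 1) = j%:Z + s by lia.
  by rewrite [2 ^+ j.+2]exprS; field; rewrite p2.
rewrite !beta_sumZ /halved add0r.
have -> : m.+2%:Z + (s - 1) = m.+1%:Z + s by lia.
rewrite expr1 => /(congr1 ( *%R 2)) e.
transitivity (2 * (c%:~R / 2 * beta_sum m.+1 (halved h s))).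
  by rewrite /halved; field.
by rewrite /halved e [2 ^+ m.+3]exprS; field; rewrite p2 -natrD pnatr_eq0.
Qed.

Lemma beta_sum_lucas_step m s :
  beta_sum m.+1 (halved lucas s) =
  beta_sum m (halved fib s) + ('F_[s - 1] + 'F_[m.+1%:Z + s] / 2 ^+ m.+2) / m.+2%:R.
Proof.
rewrite -(@beta_sum_halved_step fib lucas 1); first by rewrite mul1r.
by move=> j; rewrite mul1r lucas_fib.
Qed.

Lemma beta_sum_fib_step m s :
  5 * beta_sum m.+1 (halved fib s) =
  beta_sum m (halved lucas s) + ('L_[s - 1] + 'L_[m.+1%:Z + s] / 2 ^+ m.+2) / m.+2%:R.
Proof. exact: (@beta_sum_halved_step lucas fib 5 m s fib_lucas). Qed.

Lemma sum_inv_bin (g : int -> int) m s :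
  \sum_(0 <= j < m.+1) (g (j%:Z + s))%:~R / (2 ^+ j.+1 * 'C(m, j)%:R) =
  m.+1%:R * beta_sum m (halved g s).
Proof.
rewrite /beta_sum mulr_sumr; apply: eq_bigr => j _.
rewrite /halved /beta_weight !invfM.
have m0 : m.+1%:R != 0 :> rat by rewrite pnatr_eq0.
by rewrite [RHS]mulrCA mulVKf // mulrA.
Qed.

(** From level 2n+2, the Fibonacci step uses up one factor 5 and leaves the Lucas terms over 2n+3;
    the Lucas step then leaves the Fibonacci terms over 2n+2. *)
Lemma beta_sum_fib_even n s :
  5 ^+ n.+1 * beta_sum (2 * n) (halved fib s) =
  'F_[s - 1] * (\sum_(1 <= j < n.+1) 5 ^+ j / (2 * j)%:R)
  + 'L_[s - 1] * (\sum_(0 <= j < n.+1) 5 ^+ j / (2 * j + 1)%:R)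
  + (\sum_(1 <= j < n.+1)
        5 ^+ j * 'F_[(2 * j)%:Z + s - 1] / (2 ^+ (2 * j) * (2 * j)%:R)
     + \sum_(0 <= j < n.+1)
        5 ^+ j * 'L_[(2 * j)%:Z + s] / (2 ^+ (2 * j + 1) * (2 * j + 1)%:R)).
Proof.
elim: n => [|n IH].
  rewrite !(@big_geq _ _ _ 1) // !big_nat1 muln0 /beta_sum big_nat1.
  rewrite /halved /beta_weight bin0.
  (* At level 0 only F_s / 2 is left, and 5 F_s = 2 L_(s-1) + L_s. *)
  have := congr1 (intr : int -> rat) (fib_lucas (s - 1)).
  rewrite subrK add0r intrM (intrD _ (2 * _)) intrM => e.
  transitivity (5%:~R * 'F_[s] / 2); first by field.
  by rewrite e; field.
rewrite !(big_nat_recr n.+1) //=.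
rewrite [5 ^+ n.+2]exprSr -mulrA (_ : 2 * n.+1 = (2 * n).+2)%N; last by lia.
rewrite beta_sum_fib_step beta_sum_lucas_step addn1.
have -> : (2 * n).+2%:Z + s - 1 = (2 * n).+1%:Z + s by lia.
move: (2 ^+ (2 * n).+2) (2 ^+ (2 * n).+3) (2 * n).+2%:R (2 * n).+3%:R => p q a b.
by rewrite 2!(mulrDr (5 ^+ n.+1)) IH (invfM p) (invfM q); ring.
Qed.

(** Here the Lucas step comes first and costs no factor 5. The Fibonacci step after it does, so the
    terms over 2j carry 5^(j-1) instead of 5^j. *)
Lemma beta_sum_lucas_even n s :
  5 ^+ n * beta_sum (2 * n) (halved lucas s) =
  'F_[s - 1] * (\sum_(0 <= j < n.+1) 5 ^+ j / (2 * j + 1)%:R)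
  + 'L_[s - 1] * (\sum_(1 <= j < n.+1) 5 ^+ j.-1 / (2 * j)%:R)
  + (\sum_(0 <= j < n.+1)
        5 ^+ j * 'F_[(2 * j)%:Z + s] / (2 ^+ (2 * j + 1) * (2 * j + 1)%:R)
     + \sum_(1 <= j < n.+1)
        5 ^+ j.-1 * 'L_[(2 * j)%:Z + s - 1] / (2 ^+ (2 * j) * (2 * j)%:R)).
Proof.
elim: n => [|n IH].
  rewrite !(@big_geq _ _ _ 1) // !big_nat1 muln0 /beta_sum big_nat1.
  rewrite /halved /beta_weight bin0.
  have := congr1 (intr : int -> rat) (lucas_fib (s - 1)).
  rewrite subrK add0r intrD intrM => ->.
  by field.
rewrite !(big_nat_recr n.+1) //=.
rewrite (_ : 2 * n.+1 = (2 * n).+2)%N; last by lia.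
rewrite beta_sum_lucas_step mulrDr [X in X * beta_sum _ _]exprSr.
rewrite -mulrA beta_sum_fib_step addn1.
have -> : (2 * n).+2%:Z + s - 1 = (2 * n).+1%:Z + s by lia.
move: (2 ^+ (2 * n).+2) (2 ^+ (2 * n).+3) (2 * n).+2%:R (2 * n).+3%:R => p q a b.
by rewrite (mulrDr (5 ^+ n)) IH (invfM p) (invfM q); ring.
Qed.

Theorem theorem2 (n : nat) (s : int) :
  (\sum_(0 <= j < (2 * n).+1)
      'F_[j%:Z + s] / (2 ^+ j.+1 * 'C(2 * n, j)%:R)
   = (2 * n + 1)%:R / 5 ^+ n.+1 *
       ('F_[s - 1] * (\sum_(1 <= j < n.+1) 5 ^+ j / (2 * j)%:R)
        + 'L_[s - 1] * (\sum_(0 <= j < n.+1) 5 ^+ j / (2 * j + 1)%:R))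
     + (2 * n + 1)%:R / 5 ^+ n.+1 *
       (\sum_(1 <= j < n.+1)
           5 ^+ j * 'F_[(2 * j)%:Z + s - 1] / (2 ^+ (2 * j) * (2 * j)%:R)
        + \sum_(0 <= j < n.+1)
           5 ^+ j * 'L_[(2 * j)%:Z + s]
             / (2 ^+ (2 * j + 1) * (2 * j + 1)%:R)))
  /\
  (\sum_(0 <= j < (2 * n).+1)
      'L_[j%:Z + s] / (2 ^+ j.+1 * 'C(2 * n, j)%:R)
   = (2 * n + 1)%:R / 5 ^+ n *
       ('F_[s - 1] * (\sum_(0 <= j < n.+1) 5 ^+ j / (2 * j + 1)%:R)
        + 'L_[s - 1] * (\sum_(1 <= j < n.+1) 5 ^+ j.-1 / (2 * j)%:R))
     + (2 * n + 1)%:R / 5 ^+ n *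
       (\sum_(0 <= j < n.+1)
           5 ^+ j * 'F_[(2 * j)%:Z + s]
             / (2 ^+ (2 * j + 1) * (2 * j + 1)%:R)
        + \sum_(1 <= j < n.+1)
           5 ^+ j.-1 * 'L_[(2 * j)%:Z + s - 1]
             / (2 ^+ (2 * j) * (2 * j)%:R))).
Proof.
have n5 k : 5 ^+ k != 0 :> rat by rewrite expf_neq0 // pnatr_eq0.
(* The two brackets of each right-hand side combine into a power of 5 times a [beta_sum]; that power
   then cancels the denominator. *)
rewrite !sum_inv_bin -!mulrDr -beta_sum_fib_even -beta_sum_lucas_even addn1.
by split; rewrite -mulrA mulKf.
Qed.
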